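(* Let $G$ be a graph. Then $e(\Omega(G))=L(\Omega(G))$ and $L(\Omega(G))\leq c(\Omega(G))$.
   Context: A graph is a pair $G=(V(G),E(G))$ with $V(G)$ an arbitrary set and $E(G)\subseteq [V(G)]^2$ (two-element subsets). A ray in $G$ is an injective sequence of vertices $(v_0,v_1,\dots)$ with $\{v_i,v_{i+1}\}\in E(G)$ for all $i$; a tail of it is $(v_n,v_{n+1},\dots)$ for some $n$. For finite $F\subseteq V(G)$, $G\setminus F$ is the subgraph induced on $V(G)\setminus F$; a connected component is a maximal connected subgraph. Two rays of $G$ are equivalent if for every finite $F\subseteq V(G)$ they have tails lying in the same connected component of $G\setminus F$. An end is an equivalence class of rays, and $\Omega(G)$ is the set of ends. For an end $\epsilon$ and finite $F\subseteq V(G)$, $G(\epsilon,F)$ is the unique connected component of $G\setminus F$ containing a tail of every ray of $\epsilon$, and $\Omega(\epsilon,F)$ is the set of all ends having a ray contained in $G(\epsilon,F)$. A set $U\subseteq\Omega(G)$ is open if for every $\epsilon\in U$ there is a finite $F\subseteq V(G)$ with $\Omega(\epsilon,F)\subseteq U$; this topologizes $\Omega(G)$, the end space of $G$. For a topological space $X$: the Lindelöf degree $L(X)$ is the least infinite cardinal $\kappa$ such that every open cover of $X$ has a subcover of cardinality at most $\kappa$; the extent is $e(X)=\sup\{|C|: C \text{ is a closed discrete subset of } X\}+\aleph_0$; the cellularity is $c(X)=\sup\{|\mathcal O|:\mathcal O\text{ is a family of pairwise disjoint open subsets of }X\}+\aleph_0$. *)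

(* Defs.v *)
From Stdlib Require Import Relations.
From HB Require Import structures.
From mathcomp Require Import all_boot.
From mathcomp Require Import boolp classical_sets functions cardinality.
From mathcomp Require Import topology.

Set Implicit Arguments.
Unset Strict Implicit.
Unset Printing Implicit Defensive.

Local Open Scope classical_set_scope.
Local Open Scope card_scope.

(* Cardinal numbers are represented by types up to equipotence: the cardinal  *)
(* K is the cardinality of [set: K], equality and order of cardinals are      *)
(* [#=] and [#<=], and the sum of cardinals is the sum of types.              *)

Lemma inj_cardT (A B : Type) (f : A -> B) : injective f -> [set: A] #<= [set: B].
Proof.
move=> fI; have /injfunPex[g] : exists2 g : A -> B,
    set_fun setT setT g & set_inj setT g by exists f => // x y _ _; exact: fI.
exact: inj_card_le.
Qed.

Lemma card_leT_inj (A B : Type) : [set: A] #<= [set: B] ->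
  exists f : A -> B, injective f.
Proof.
move=> /card_leP[f]; exists (fun x => set_val (f (to_setT x))) => x y.
by move=> /val_inj/inj; rewrite !inE => /(_ Logic.I Logic.I)/(congr1 set_val).
Qed.

(* Zorn's lemma on the partial transversals of the family: in a maximal one,  *)
(* some projection is surjective.                                             *)
Lemma least_card_family (I : Type) (K : I -> Type) : I ->
  exists i, forall j, [set: K i] #<= [set: K j].
Proof.
move=> i0; pose Pi := forall i : I, K i.
pose Q (S : set Pi) := forall i s t, S s -> S t -> s i = t i -> s = t.
have [F FQ tF|S [QS Smax]] := @Zorn_bigcup Pi Q.
  move=> i s t [A FA As] [B FB Bt] st.
  have [AB|BA] := tF _ _ FA FB.
    by apply: (FQ _ FB i) => //; exact: AB.
  by apply: (FQ _ FA i) => //; exact: BA.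
have [[i iS]|/forallNP noS] :=
    pselect (exists i : I, forall x : K i, exists2 s, S s & s i = x).
  exists i => j.
  have /choice[g gP] : forall x : K i, exists s, S s /\ s i = x.
    by move=> x; have [s] := iS x; exists s.
  apply: (@inj_cardT _ (K j) (fun x => g x j)) => x y gxy.
  have [[Sx <-] [Sy <-]] := (gP x, gP y).
  by congr (_ i); exact: (QS j).
have /(_ _)/cid : forall i : I, exists x : K i, forall s, S s -> s i <> x.
  move=> i; have /existsNP[x xP] := noS i; exists x => s Ss sx.
  by apply: xP; exists s.
move=> /all_sig[a aP]; exfalso.
apply: (Smax (a |` S)).
  split; first by move=> x Sx; right.
  by move=> /(_ a (or_introl erefl)) Sa; exact: (aP i0 a).
move=> i s t [->|Ss] [->|St] // st; last exact: (QS i).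
- by case: (aP i t).
- by case: (aP i s).
Qed.

Lemma card_leT_total (A B : Type) :
  [set: A] #<= [set: B] \/ [set: B] #<= [set: A].
Proof.
have [[] min] := @least_card_family bool (fun b => if b then A else B) true.
  by left; exact: (min false).
by right; exact: (min true).
Qed.

Lemma least_card_exists (P : Type -> Prop) : (exists K, P K) ->
  exists K, P K /\ forall K', P K' -> [set: K] #<= [set: K'].
Proof.
move=> [K0 PK0].
pose I := {A : set K0 | exists K, P K /\ [set: K] #= A}.
have I0 : I by exists setT, K0.
have [[A [K [PK KA]]] Amin] :=
  least_card_family (fun i : I => set_type (proj1_sig i)) I0.
exists K; split=> // K' PK'; rewrite (card_le_eql KA).
have [K0K'|/card_leT_inj[f fI]] := card_leT_total K0 K'.
  by apply: card_le_trans K0K'; exact: subset_card_le.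
have K'B : [set: K'] #= range f by apply/card_esym/inj_card_eq => x y _ _; exact: fI.
rewrite (card_le_eqr K'B) -(card_le_eql (card_setT A)).
rewrite -(card_le_eqr (card_setT (range f))).
exact: (Amin (exist _ (range f) (ex_intro _ K' (conj PK' K'B)))).
Qed.

Definition least_card (P : Type -> Prop) (exP : exists K, P K) : Type :=
  projT1 (cid (least_card_exists exP)).

Lemma least_cardP (P : Type -> Prop) (exP : exists K, P K) :
  P (least_card exP) /\
  forall K, P K -> [set: least_card exP] #<= [set: K].
Proof. exact: (projT2 (cid (least_card_exists exP))). Qed.

Definition card_ubound (T : Type) (A : set (set T)) (K : Type) : Prop :=
  forall C, A C -> C #<= [set: K].

Lemma card_ubound_exists (T : Type) (A : set (set T)) :
  exists K, card_ubound A K.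
Proof. by exists T => C _; apply: subset_card_le. Qed.

Definition card_sup (T : Type) (A : set (set T)) : Type :=
  least_card (card_ubound_exists A).

Definition open_cover (X : topologicalType) (U : set (set X)) : Prop :=
  U `<=` open /\ \bigcup_(A in U) A = [set: X].

Definition lindelof_bound (X : topologicalType) (K : Type) : Prop :=
  infinite_set [set: K] /\
  forall U : set (set X), open_cover U ->
    exists V : set (set X),
      [/\ V `<=` U, \bigcup_(A in V) A = [set: X] & V #<= [set: K]].

Lemma lindelof_bound_exists (X : topologicalType) :
  exists K, lindelof_bound X K.
Proof.
exists (set X + nat)%type; split.
  apply/infiniteP; apply: (@inj_cardT nat (set X + nat)%type inr).
  by move=> x y [].
move=> U [_ covU]; exists U; split=> //.
apply: (card_le_trans (subset_card_le (@subsetT _ U))).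
by apply: (@inj_cardT _ (set X + nat)%type inl) => x y [].
Qed.

Definition lindelof_degree (X : topologicalType) : Type :=
  least_card (lindelof_bound_exists X).

Definition closed_discrete (X : topologicalType) (C : set X) : Prop :=
  closed C /\ C `<=` isolated C.

Definition extent (X : topologicalType) : Type :=
  (card_sup (@closed_discrete X) + nat)%type.

Definition cellular (X : topologicalType) (O : set (set X)) : Prop :=
  O `<=` open /\ trivIset O id.

Definition cellularity (X : topologicalType) : Type :=
  (card_sup (@cellular X) + nat)%type.

(* The edges are the pairs {u, v} with [adj u v].                             *)

Record graph := Graph {
  vertex :> Type;
  adj : vertex -> vertex -> Prop;
  adj_sym : forall u v, adj u v -> adj v u;
  adj_irr : forall u, ~ adj u u
}.

Record ray (G : graph) := Ray {
  ray_fun :> nat -> G;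
  ray_inj : injective ray_fun;
  ray_adj : forall n, adj (ray_fun n) (ray_fun n.+1)
}.

Section Ends.
Variable G : graph.
Implicit Types (C D F : set G) (r s : ray G).

Definition linked C : G -> G -> Prop :=
  clos_refl_trans G (fun u v => [/\ C u, C v & adj u v]).

(* C induces a connected subgraph; connected graphs are nonempty.             *)
Definition graph_connected C : Prop :=
  C !=set0 /\ forall u v, C u -> C v -> linked C u v.

(* A component, being a maximal connected subgraph, is induced, and so it is  *)
(* identified with its vertex set.                                            *)
Definition component F C : Prop :=
  [/\ C `<=` ~` F, graph_connected C &
      forall D, C `<=` D -> D `<=` ~` F -> graph_connected D -> D = C].

Definition has_tail_in r C : Prop := exists n, forall i, n <= i -> C (r i).

Definition ray_equiv r s : Prop :=
  forall F, finite_set F ->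
    exists C, [/\ component F C, has_tail_in r C & has_tail_in s C].

Definition end_space : Type :=
  {eps : set (ray G) | exists r, eps = [set s | ray_equiv r s]}.

Definition end_rays (eps : end_space) : set (ray G) := proj1_sig eps.

(* G(eps, F): [get] picks the C satisfying the predicate. For finite F it     *)
(* exists and is unique: end_componentP and end_component_unique below.       *)
Definition end_component (eps : end_space) F : set G :=
  get [set C | component F C /\ forall r, end_rays eps r -> has_tail_in r C].

Definition end_nbhd (eps : end_space) F : set end_space :=
  [set eta | exists2 r, end_rays eta r & range r `<=` end_component eps F].

Definition end_open (U : set end_space) : Prop :=
  forall eps, U eps -> exists2 F, finite_set F & end_nbhd eps F `<=` U.

Lemma linkedS C D u v : C `<=` D -> linked C u v -> linked D u v.
Proof.
move=> CD; elim=> [x y [Cx Cy xy]|x|x y z _ xy _ yz].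
- by apply: rt_step; split=> //; exact: CD.
- exact: rt_refl.
- exact: rt_trans yz.
Qed.

Lemma graph_connected_bigcup (P : set (set G)) c : P !=set0 ->
  (forall C, P C -> C c /\ graph_connected C) ->
  graph_connected (\bigcup_(C in P) C).
Proof.
move=> [C0 PC0] Pc; split; first by exists c, C0 => //; have [] := Pc _ PC0.
move=> u v [C PC Cu] [D PD Dv]; apply: (@rt_trans _ _ _ c).
  have [Cc [_ Cco]] := Pc _ PC.
  by apply: (linkedS (bigcup_sup PC)); exact: Cco.
have [Dc [_ Dco]] := Pc _ PD.
by apply: (linkedS (bigcup_sup PD)); exact: Dco.
Qed.

Lemma component_exists F C : C `<=` ~` F -> graph_connected C ->
  exists2 D, component F D & C `<=` D.
Proof.
move=> CF Cco; have [[c Cc] _] := Cco.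
pose P : set (set G) := [set D | [/\ D `<=` ~` F, D c & graph_connected D]].
have PC : P C by [].
exists (\bigcup_(D in P) D); last exact: bigcup_sup.
split.
- by move=> x [D [DF _ _] Dx]; exact: DF.
- by apply: (@graph_connected_bigcup P c); [exists C|move=> D []].
- move=> D PD DF Dco; apply/seteqP; split=> //; apply: bigcup_sup; split=> //.
  by apply: PD; exists C.
Qed.

Lemma component_eq F C D x : component F C -> component F D -> C x -> D x ->
  C = D.
Proof.
move=> [CF Cco Cmax] [DF Dco Dmax] Cx Dx.
have co : graph_connected (\bigcup_(E in [set C; D]) E).
  by apply: (@graph_connected_bigcup _ x); [exists C; left|move=> E [->|->]].
have sF : \bigcup_(E in [set C; D]) E `<=` ~` F.
  by move=> y [E [->|->]]; [exact: CF|exact: DF].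
rewrite -(Cmax _ _ sF co); last by apply: bigcup_sup; left.
by apply: Dmax => //; apply: bigcup_sup; right.
Qed.

Lemma component_tail_eq F C D r : component F C -> component F D ->
  has_tail_in r C -> has_tail_in r D -> C = D.
Proof.
move=> cC cD [m Cm] [n Dn]; apply: (component_eq cC cD (x := r (maxn m n))).
  by apply: Cm; exact: leq_maxl.
by apply: Dn; exact: leq_maxr.
Qed.

Lemma component_tail_exists F r : finite_set F ->
  exists2 C, component F C & has_tail_in r C.
Proof.
move=> Ffin.
have fin_bounded k (A : set nat) : A #= `I_k -> exists n, forall i, n <= i -> ~ A i.
  elim: k A => [|k IH] A; first by rewrite II0 card_eq0 => /eqP->; exists 0 => ? _ [].
  move=> /eq_cardSP[x Ax /IH[n nA]]; exists (maxn n x.+1) => i.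
  rewrite geq_max => /andP[ni xi] Ai; apply: (nA i ni); split=> // ix.
  by move: xi; rewrite ix ltnn.
have [n nF] : exists n, forall i, n <= i -> ~ F (r i).
  have /finite_setP[k /fin_bounded//] : finite_set (r @^-1` F).
  by apply: finite_preimage => // x y _ _; exact: ray_inj.
pose T : set G := [set r i | i in [set i | n <= i]].
have Tsucc i : n <= i -> [/\ T (r i), T (r i.+1) & adj (r i) (r i.+1)].
  move=> ni; split; [by exists i| |exact: ray_adj].
  by exists i.+1 => //=; exact: leqW.
have Tup i j : n <= i -> i <= j -> linked T (r i) (r j).
  move=> ni; elim: j => [|j IH]; first by rewrite leqn0 => /eqP->; exact: rt_refl.
  rewrite leq_eqVlt => /predU1P[->|ij]; first exact: rt_refl.
  by apply: (rt_trans _ _ _ _ _ (IH ij)); apply: rt_step; exact/Tsucc/(leq_trans ni).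
have Tsym u v : linked T u v -> linked T v u.
  elim=> [x y [Tx Ty xy]|x|x y z _ yx _ zy].
  - by apply: rt_step; split=> //; exact: adj_sym.
  - exact: rt_refl.
  - exact: rt_trans yx.
have Tco : graph_connected T.
  split; first by exists (r n); exists n => /=.
  move=> _ _ [i ni <-] [j nj <-]; have [ij|/ltnW ji] := leqP i j.
    exact: Tup.
  exact/Tsym/Tup.
have TF : T `<=` ~` F by move=> _ [i ni <-]; exact: nF.
have [C cC TC] := component_exists TF Tco.
by exists C => //; exists n => i ni; apply: TC; exists i.
Qed.

Lemma ray_equiv_refl r : ray_equiv r r.
Proof. by move=> F /(component_tail_exists r)[C cC rC]; exists C. Qed.

Lemma ray_equiv_sym r s : ray_equiv r s -> ray_equiv s r.
Proof. by move=> rs F /rs[C [cC rC sC]]; exists C. Qed.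

Lemma ray_equiv_trans r s t : ray_equiv r s -> ray_equiv s t -> ray_equiv r t.
Proof.
move=> rs st F Ffin; have [C [cC rC sC]] := rs _ Ffin.
have [D [cD sD tD]] := st _ Ffin.
by exists C; split=> //; rewrite (component_tail_eq cC cD sC sD).
Qed.

Lemma end_componentP (eps : end_space) F : finite_set F ->
  component F (end_component eps F) /\
  forall r, end_rays eps r -> has_tail_in r (end_component eps F).
Proof.
case: eps => eps [r0 epsE] Ffin; rewrite /end_component /end_rays /=.
have [C cC r0C] := component_tail_exists r0 Ffin.
apply: (@getPex _
  [set C | component F C /\ forall r, eps r -> has_tail_in r C]).
exists C; split=> // r; rewrite epsE => /(_ _ Ffin)[D [cD r0D rD]].
by rewrite (component_tail_eq cC cD r0C r0D).
Qed.

Lemma end_component_unique (eps : end_space) F C : finite_set F ->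
  component F C -> (forall r, end_rays eps r -> has_tail_in r C) ->
  C = end_component eps F.
Proof.
move=> Ffin cC epsC; have [cE epsE] := end_componentP eps Ffin.
have [r epsr] : exists r, end_rays eps r.
  case: eps {epsC cE epsE} => eps [r epsr]; exists r; rewrite /end_rays /= epsr.
  exact: ray_equiv_refl.
by apply: (component_tail_eq cC cE (r := r)); [exact: epsC|exact: epsE].
Qed.

Lemma end_componentS (eps : end_space) F F' : finite_set F' -> F `<=` F' ->
  end_component eps F' `<=` end_component eps F.
Proof.
move=> F'fin FF'; have Ffin := sub_finite_set FF' F'fin.
have [[CF' Cco _] epsC] := end_componentP eps F'fin.
have [|D cD CD] := @component_exists F _ _ Cco.
  by move=> x /CF' F'x /FF'.
rewrite -(end_component_unique Ffin cD) // => r /epsC[n nC].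
by exists n => i /nC/CD.
Qed.

Lemma end_openT : end_open setT.
Proof. by move=> eps _; exists set0. Qed.

Lemma end_openI : setI_closed end_open.
Proof.
move=> U V oU oV eps [/oU[F Ffin FU] /oV[F' F'fin F'V]].
have FFfin : finite_set (F `|` F') by rewrite finite_setU.
exists (F `|` F') => // eta [r etar rC]; split.
  apply: FU; exists r => //; apply: (subset_trans rC).
  exact: (end_componentS FFfin (@subsetUl _ _ _)).
apply: F'V; exists r => //; apply: (subset_trans rC).
exact: (end_componentS FFfin (@subsetUr _ _ _)).
Qed.

Lemma end_open_bigU (I : Type) (f : I -> set end_space) :
  (forall i, end_open (f i)) -> end_open (\bigcup_i f i).
Proof.
move=> fo eps [i _ /fo[F Ffin Ff]]; exists F => // eta /Ff feta.
by exists i.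
Qed.

HB.instance Definition _ := gen_eqMixin end_space.
HB.instance Definition _ := gen_choiceMixin end_space.
HB.instance Definition _ := isOpenTopological.Build end_space
  end_openT end_openI end_open_bigU.

Lemma end_space_openE : (open : set (set end_space)) = end_open.
Proof. by []. Qed.

End Ends.

(* Main.v *)
Require Import Defs.
From Stdlib Require Import Relations.
From mathcomp Require Import all_boot boolp classical_sets functions cardinality topology.

Set Implicit Arguments.
Unset Strict Implicit.
Unset Printing Implicit Defensive.

Local Open Scope classical_set_scope.
Local Open Scope card_scope.


(** End spaces are ultraparacompact: every open cover is refined by a partition
    into open sets ([ends_splittable]). Choosing an end in every piece of such a
    partition gives a closed discrete set, since points are closed, and the
    pieces themselves are disjoint open sets; so the number of nonempty pieces,
    hence the size of some subcover, is bounded by the extent and by the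
    cellularity ([lindelof_le_partition]). The inequality between extent and
    Lindelöf degree in the other direction holds in every topological space.

    Ultraparacompactness is proved by contradiction. Call a component [D] of the
    graph minus a finite set bad if the ends living in [D] have no such
    partition. Deleting finitely many more vertices distributes the ends of [D]
    over disjoint open sets, one for each new component, so a bad [D] contains a
    bad new component ([unsplittable_component]). Iterating this produces
    decreasing bad components [D n] and finite connected sets [S n] in [D n],
    where [D n.+1] is a component of [D n] minus [S n] and [S n.+1] contains a
    neighbour of [S n]. A ray runs through the sets [S n]; its end has a
    neighbourhood contained in a member of the cover, given by deleting a finite
    set [F], and a component which avoids [F] and meets a late [S n] lies in that
    neighbourhood, hence is not bad.

    What could go wrong is that a part [F0] of [F] lies in all [D n] and cuts
    off the badness of [D n] from the ray. Each step therefore ensures one of two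
    things ([step_exists]). Either no deletion of a finite subset of [D n.+1] from
    [D n] leaves a bad component disjoint from [S n]; then deleting [F0] from a
    late [D n] leaves no bad component at all, which is absurd. Or [S n] is not
    adjacent to [D n.+2]; if this happens at all late steps then no vertex lies in
    all [D n], so [F0] is empty and a late [D n] itself avoids [F]. *)

(** * Cardinals and covers *)

(** Hilbert's hotel: the points of a copy of [nat] inside [K] move to the even
    places of that copy, which leaves the odd ones for the new guests. *)
Lemma card_le_add_nat (A K : Type) : infinite_set [set: K] ->
  [set: A] #<= [set: K] -> [set: (A + nat)%type] #<= [set: K].
Proof.
move=> /infiniteP/card_leT_inj[f fI] /card_leT_inj[g gI].
pose move_in k := if pselect (exists n, f n = k) is left e
  then f (projT1 (cid e)).*2 else k.
have move_inP k : (exists n, k = f n /\ move_in k = f n.*2) \/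
    ((forall n, f n <> k) /\ move_in k = k).
  rewrite /move_in; case: pselect => [e|ne]; last first.
    by right; split=> // n fn; apply: ne; exists n.
  by left; case: cid => n /= fn; exists n.
apply: (inj_cardT (f := fun x : A + nat =>
  match x with inl a => move_in (g a) | inr n => f n.*2.+1 end)).
have odd_free n k : move_in k <> f n.*2.+1.
  case: (move_inP k) => [[m [_ ->]] /fI|[kf ->] fk].
    by move=> /(congr1 odd) /=; rewrite !odd_double.
  exact: (kf n.*2.+1).
case=> [a|m] [b|n] /= xy.
- congr inl; apply: gI; move: xy.
  case: (move_inP (g a)) => [[m [-> ->]]|[af ->]];
    case: (move_inP (g b)) => [[n [-> ->]]|[bf ->]] //.
  + by move=> /fI/double_inj->.
  + by move=> /bf.
  + by move=> /esym/af.
- by case: (odd_free n (g a)).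
- by case: (odd_free m (g b)).
- by move: xy => /fI[/double_inj->].
Qed.

Lemma card_sup_ge (T : Type) (A : set (set T)) C : A C ->
  C #<= [set: card_sup A].
Proof. exact: (proj1 (least_cardP (card_ubound_exists A))). Qed.

Lemma card_sup_le (T : Type) (A : set (set T)) K :
  (forall C, A C -> C #<= [set: K]) -> [set: card_sup A] #<= [set: K].
Proof. exact: (proj2 (least_cardP (card_ubound_exists A))). Qed.

Lemma infinite_add_nat (A : Type) : infinite_set [set: (A + nat)%type].
Proof. by apply/infiniteP; apply: (@inj_cardT nat _ inr) => x y []. Qed.

Lemma card_le_sum_nat (A : Type) : [set: A] #<= [set: (A + nat)%type].
Proof. by apply: (@inj_cardT _ _ inl) => x y []. Qed.

Lemma card_le_injon (T U : Type) (A : set T) (B : set U) (f : T -> U) :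
  (forall x, A x -> B (f x)) ->
  (forall x y, A x -> A y -> f x = f y -> x = y) -> A #<= B.
Proof.
move=> fAB fI; have fAI : {in A &, injective f}.
  by move=> x y /set_mem Ax /set_mem Ay; exact: fI.
rewrite -(card_le_eql (inj_card_eq fAI)).
by apply: subset_card_le => _ [x Ax <-]; exact: fAB.
Qed.

(** Every point of a discrete closed set has a neighbourhood meeting it in that
    point only, so the open sets meeting it in at most one point cover the
    space; a subcover must spend a different member on each point. *)
Lemma closed_discrete_card_le_lindelof (X : topologicalType) K (C : set X) :
  lindelof_bound X K -> closed_discrete C -> C #<= [set: K].
Proof.
move=> [_ linK] [clC isoC].
pose W : set (set X) := [set O | open O /\
  forall x y, O x -> O y -> C x -> C y -> x = y].
have [|V [VW covV]] := linK W.
  split=> [O []//|]; apply/seteqP; split=> // x _.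
  have [Cx|nCx] := pselect (C x); last first.
    exists (~` C) => //=; split; first exact: closed_openC.
    by move=> y z nCy _ /nCy.
  have [_ [B nB BC]] := isoC x Cx.
  move: nB; rewrite nbhsE => -[O [oO Ox] OB].
  exists O => //; split=> // y z Oy Oz Cy Cz.
  have only u : O u -> C u -> u = x.
    by move=> Ou Cu; have : (B `&` C) u by [split=> //; exact: OB]; rewrite BC.
  by rewrite (only y) // (only z).
apply: card_le_trans => //.
have /choice[O OP] : forall x, exists O, V O /\ O x.
  move=> x; have : [set: X] x by [].
  by rewrite -covV => -[O VO Ox]; exists O.
apply: (@card_le_injon _ _ _ _ O) => [x _|x y Cx Cy Oxy]; first by case: (OP x).
have [[VOx Oxx] [_ Oyy]] := (OP x, OP y).
by have [_] := VW _ VOx; apply=> //; rewrite Oxy.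
Qed.

Lemma extent_le_lindelof (X : topologicalType) :
  [set: extent X] #<= [set: lindelof_degree X].
Proof.
have [linL _] := least_cardP (lindelof_bound_exists X).
apply: card_le_add_nat; first by case: linL.
by apply: card_sup_le => C; exact: closed_discrete_card_le_lindelof.
Qed.

(** * Open partitions *)

Definition open_partition_refining (X : topologicalType) (U : set (set X))
    (A : set X) (P : set (set X)) : Prop :=
  [/\ P `<=` open, trivIset P id, \bigcup_(V in P) V = A &
      forall V, P V -> exists2 O, U O & V `<=` O].

(** A space is ultraparacompact when [splittable U setT] holds for every open
    cover [U]. *)
Definition splittable (X : topologicalType) (U : set (set X)) (A : set X) :=
  exists P, open_partition_refining U A P.

Lemma splittable_open (X : topologicalType) (U : set (set X)) (A O : set X) :
  open A -> U O -> A `<=` O -> splittable U A.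
Proof.
move=> oA UO AO; exists [set A]; split.
- by move=> _ ->.
- by move=> V W -> ->.
- by rewrite bigcup_set1.
- by move=> _ ->; exists O.
Qed.

Lemma splittable_bigcup (X : topologicalType) (U : set (set X))
    (A : set (set X)) :
  trivIset A id -> (forall B, A B -> splittable U B) ->
  splittable U (\bigcup_(B in A) B).
Proof.
move=> tA sA.
have /choice[P PP] : forall B, exists P, A B -> open_partition_refining U B P.
  move=> B; have [/sA[P]|nA] := pselect (A B); first by exists P.
  by exists set0.
exists (\bigcup_(B in A) P B); split.
- by move=> V [B /PP[oP _ _ _] /oP].
- move=> V W [B AB PV] [C AC PW] [x [/= Vx Wx]].
  have [[_ tB BE _] [_ _ CE _]] := (PP B AB, PP C AC).
  have BC : B = C.
    apply: tA => //; exists x; split.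
      by rewrite -BE; exists V.
    by rewrite -CE; exists W.
  by apply: tB => //; [rewrite BC|exists x].
- apply/seteqP; split=> x.
    move=> [V [B AB PV] Vx]; exists B => //.
    by have [_ _ <- _] := PP B AB; exists V.
  move=> [B AB]; have [_ _ <- _] := PP B AB => -[V PV Vx].
  by exists V => //; exists B.
- by move=> V [B AB PV]; have [_ _ _] := PP B AB; apply.
Qed.

(** A subcover needs only one member for each nonempty piece of a partition
    refining the cover. *)
Lemma lindelof_le_partition (X : topologicalType) (K : Type) :
  infinite_set [set: K] ->
  (forall U : set (set X), open_cover U -> exists2 P,
      open_partition_refining U setT P & P `\ set0 #<= [set: K]) ->
  [set: lindelof_degree X] #<= [set: K].
Proof.
move=> infK HK; apply: (proj2 (least_cardP (lindelof_bound_exists X))).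
split=> // U covU; have [P [oP tP PE PU] PK] := HK U covU.
have /choice[O OP] : forall V, exists O, P V -> U O /\ V `<=` O.
  move=> V; have [/PU[O UO VO]|nP] := pselect (P V); first by exists O.
  by exists set0.
exists (O @` (P `\ set0)); split.
- by move=> _ [V [/OP[UO _] _] <-].
- apply/seteqP; split=> // x _; have : [set: X] x by [].
  rewrite -PE => -[V PV Vx]; exists (O V); last by apply: (proj2 (OP V PV)).
  by exists V => //; split=> // V0; move: Vx; rewrite V0.
- exact: card_le_trans (card_image_le _ _) PK.
Qed.

Lemma partition_card_le_cellularity (X : topologicalType) U P :
  @open_partition_refining X U setT P -> P #<= [set: cellularity X].
Proof.
move=> [oP tP _ _]; apply: (card_le_trans (B := [set: card_sup (@cellular X)])).
  exact: card_sup_ge.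
exact: card_le_sum_nat.
Qed.

(** Choosing a point in every nonempty piece gives a closed discrete set with
    one point per piece; it is closed because a piece minus its chosen point is
    open. *)
Lemma partition_card_le_extent (X : topologicalType) U P :
  (forall x : X, closed [set x]) ->
  @open_partition_refining X U setT P -> P `\ set0 #<= [set: extent X].
Proof.
move=> cl1 [oP tP PE _].
have [->|/set0P[V0 [_ /eqP/set0P[x0 _]]]] := eqVneq (P `\ set0) set0.
  exact: card_ge0.
have /choice[c cP] : forall V : set X, exists x, V !=set0 -> V x.
  move=> V; have [[x Vx]|nV] := pselect (V !=set0); first by exists x.
  by exists x0.
have cV V : (P `\ set0) V -> V (c V) by move=> [_ /eqP/set0P/cP].
have cU V x : (P `\ set0) V -> P x -> x (c V) -> x = V.
  move=> PV Px xc; apply: tP => //; first by case: PV.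
  by exists (c V); split=> //; exact: cV.
pose C := c @` (P `\ set0).
have Conly V y : P V -> V y -> C y -> y = c V.
  by move=> PV Vy [W PW Wy]; rewrite -Wy (cU W V) // Wy.
apply: (card_le_trans (B := C)).
  apply: (@card_le_injon _ _ _ _ c) => [V PV|V W PV PW cVW]; first by exists V.
  by apply: (cU W V PW); [case: PV|rewrite -cVW; exact: cV].
apply: (card_le_trans (B := [set: card_sup (@closed_discrete X)]));
  last exact: card_le_sum_nat.
apply: card_sup_ge; split.
  rewrite -[C]setCK; apply: open_closedC.
  have -> : ~` C = \bigcup_(V in P) (V `&` ~` [set x | x = c V /\ C x]).
    apply/seteqP; split=> x.
      move=> nCx; have : [set: X] x by [].
      by rewrite -PE => -[V PV Vx]; exists V => //; split=> // -[_ /nCx].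
    by move=> [V PV [Vx nx]] Cx; apply: nx; split; first exact: Conly.
  apply: bigcup_open => V PV; apply: openI; first exact: oP.
  have [Cc|nCc] := pselect (C (c V)).
    have -> : [set x | x = c V /\ C x] = [set c V].
      by apply/seteqP; split=> x; [case|move=> ->].
    by apply: closed_openC; exact: cl1.
  have -> : [set x | x = c V /\ C x] = set0.
    by apply/seteqP; split=> // x [-> /nCc].
  by rewrite setC0; exact: openT.
move=> x Cx; split; first exact: mem_set.
have [V PV Vx] : exists2 V, P V & V x.
  by have : [set: X] x by []; rewrite -PE => -[V]; exists V.
exists V; first by apply: open_nbhs_nbhs; split=> //; exact: oP.
apply/seteqP; split=> y; last by move=> ->.
by move=> [Vy Cy]; rewrite /= (Conly V y) // (Conly V x).
Qed.

(** * Connected sets of vertices *)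

Section Connected.
Variable G : graph.
Implicit Types (A C D F K Q S T : set G) (u v x : G).

Lemma linked_sym C u v : linked C u v -> linked C v u.
Proof.
elim=> [x y [Cx Cy xy]|x|x y z _ yx _ zy].
- by apply: rt_step; split=> //; exact: adj_sym.
- exact: rt_refl.
- exact: rt_trans yx.
Qed.

Lemma linked_mem C u v : linked C u v -> C u -> C v.
Proof. by elim=> [x y []|x|x y z _ xy _ yz /xy/yz]. Qed.

Lemma graph_connectedP C c : C c -> (forall x, C x -> linked C c x) ->
  graph_connected C.
Proof.
move=> Cc cC; split; first by exists c.
by move=> u v /cC cu /cC cv; apply: rt_trans cv; exact: linked_sym.
Qed.

Lemma graph_connected1 x : graph_connected [set x].
Proof. by apply: (@graph_connectedP _ x) => // y ->; exact: rt_refl. Qed.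

Lemma graph_connectedU C D : (C `&` D) !=set0 ->
  graph_connected C -> graph_connected D -> graph_connected (C `|` D).
Proof.
move=> [c [Cc Dc]] [_ Cco] [_ Dco].
apply: (@graph_connectedP _ c) => [|x [Cx|Dx]]; first by left.
  by apply: (linkedS (@subsetUl _ C D)); exact: Cco.
by apply: (linkedS (@subsetUr _ C D)); exact: Dco.
Qed.

Lemma graph_connected2 u v : adj u v -> graph_connected [set u; v].
Proof.
move=> uv; apply: (@graph_connectedP _ u) => [|x [->|->]]; first by left.
  exact: rt_refl.
by apply: rt_step; split=> //; [left|right].
Qed.

Lemma linked_finite D u v : linked D u v -> D u ->
  exists S, [/\ finite_set S, S `<=` D, graph_connected S, S u & S v].
Proof.
elim=> [x y [Dx Dy xy] _|x Dx|x y z xy IHx yz IHy Dx].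
- exists [set x; y]; split; first exact: finite_set2.
  + by move=> z [->|->].
  + exact: graph_connected2.
  + by left.
  + by right.
- exists [set x]; split=> //.
  + by move=> z ->.
  + exact: graph_connected1.
have [S [Sfin SD Sco Sx Sy]] := IHx Dx.
have [T [Tfin TD Tco Ty Tz]] := IHy (linked_mem xy Dx).
exists (S `|` T); split; first by rewrite finite_setU.
- by move=> t [/SD|/TD].
- by apply: graph_connectedU => //; exists y.
- by left.
- by right.
Qed.

(** A finite union of finite connected sets through [x], one for each vertex of
    [Q]. *)
Lemma finite_connected_hull D Q x : graph_connected D -> D x ->
  finite_set Q -> Q `<=` D ->
  exists S, [/\ finite_set S, S `<=` D, graph_connected S, S x & Q `<=` S].
Proof.
move=> [_ Dco] Dx /(@finite_seqP {classic G})[s ->].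
elim: s => [_|y s IH sD].
  exists [set x]; split=> //.
  + by move=> z ->.
  + exact: graph_connected1.
have Dy : D y by apply: sD => /=; rewrite mem_head.
have [|S [Sfin SD Sco Sx sS]] := IH.
  by move=> z zs; apply: sD; rewrite /= inE; apply/orP; right.
have [T [Tfin TD Tco Tx Ty]] := linked_finite (Dco x y Dx Dy) Dx.
exists (S `|` T); split; first by rewrite finite_setU.
- by move=> t [/SD|/TD].
- by apply: graph_connectedU => //; exists x.
- by left.
- move=> z /=; rewrite inE => /orP[/eqP->|zs]; first by right.
  by left; exact: sS.
Qed.

Lemma connected_leaving_edge D A u v : graph_connected D -> D u -> D v ->
  A u -> ~ A v -> exists a b, [/\ A a, D b, ~ A b & adj a b].
Proof.
move=> [_ Dco] Du Dv; have := Dco u v Du Dv.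
elim=> [x y [Dx Dy xy]|x|x y z _ IHx _ IHy] Ax nAy //; first by exists x, y.
by have [/IHy|/(IHx Ax)] := pselect (A y); first exact.
Qed.

Lemma connected_sub_component K C T x : component K C -> graph_connected T ->
  T `<=` ~` K -> C x -> T x -> T `<=` C.
Proof.
move=> cC Tco TK Cx Tx; have [E cE TE] := component_exists TK Tco.
by rewrite (component_eq cC cE Cx (TE _ Tx)).
Qed.

Lemma component_adj K C u v : component K C -> C u -> adj u v -> ~ K v -> C v.
Proof.
move=> cC Cu uv Kv; have [CK _ _] := cC.
apply: (connected_sub_component (x := u) cC (graph_connected2 uv)) => //.
- by move=> x [->|->] //; exact: CK.
- by left.
- by right.
Qed.

(** * Rays through a sequence of connected sets *)

Definition tail_union (S : nat -> set G) n : set G :=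
  [set x | exists2 k, n <= k & S k x].

Lemma tail_union_connected (S : nat -> set G) n :
  (forall k, graph_connected (S k)) ->
  (forall k, exists u v, [/\ S k u, S k.+1 v & adj u v]) ->
  graph_connected (tail_union S n).
Proof.
move=> Sco Sadj; have [[a Sa] _] := Sco n.
have Ssub k u v : n <= k -> S k u -> S k v -> linked (tail_union S n) u v.
  move=> nk Su Sv; apply: (@linkedS _ (S k)); last by have [_] := Sco k; apply.
  by move=> x Sx; exists k.
apply: (@graph_connectedP _ a) => [|x [k nk]]; first by exists n.
elim: k nk x => [|k IH].
  by rewrite leqn0 => /eqP n0 x Sx; apply: (Ssub 0) => //; rewrite -n0.
rewrite leq_eqVlt => /predU1P[nk|nk] x Sx.
  by apply: (Ssub n) => //; rewrite nk.
have [u [v [Su Sv uv]]] := Sadj k.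
apply: rt_trans (IH nk u Su) _; apply: (@rt_trans _ _ _ v).
  by apply: rt_step; split=> //; [exists k|exists k.+1 => //; exact: leqW].
by apply: (Ssub k.+1) => //; exact: leqW.
Qed.

Let V : eqType := {classic G}.
Let e : rel V := fun u v => `[<adj u v>].

Lemma linked_simple_path C u v : linked C u v -> C u ->
  exists p : seq V, [/\ path e u p, last (u : V) p = v, uniq ((u : V) :: p) &
    forall x : V, x \in (u : V) :: p -> C x].
Proof.
move=> uv Cu; have [p [ep lp pC]] : exists p : seq V,
    [/\ path e u p, last (u : V) p = v & forall x : V, x \in (u : V) :: p -> C x].
  elim: uv Cu => [x y [Cx Cy xy] _|x Cx|x y z xy IHx yz IHy Cx].
  - exists [:: y : V]; split=> //=; first by rewrite andbT; apply/asboolP.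
    by move=> z; rewrite !inE => /orP[]/eqP->.
  - by exists [::]; split=> //= z; rewrite inE => /eqP->.
  have [p [ep lp pC]] := IHx Cx.
  have [q [eq lq qC]] := IHy (linked_mem xy Cx).
  exists (p ++ q); split; first by rewrite cat_path ep lp.
    by rewrite last_cat lp.
  move=> t; rewrite inE mem_cat orbA => /orP[tp|tq].
    by apply: pC; rewrite inE.
  by apply: qC; rewrite inE tq orbT.
case/shortenP: ep lp => q eq uq qp lq; exists q; split=> // x.
by rewrite inE => /orP[/eqP->//|/qp xp]; apply: pC; rewrite inE xp orbT.
Qed.

(** Inside each set a simple path leads from the vertex of arrival to a vertex
    of departure; the concatenation of these paths is injective because the
    sets are disjoint. *)
Lemma ray_through (S : nat -> set G) :
  (forall k, graph_connected (S k)) ->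
  (forall j k x, S j x -> S k x -> j = k) ->
  (forall k, exists u v, [/\ S k u, S k.+1 v & adj u v]) ->
  exists r : ray G, forall n, has_tail_in r (tail_union S n).
Proof.
move=> Sco Sdis /choice[out /choice[inn io]].
pose a k : V := if k is j.+1 then inn j else out 0.
have aS k : S k (a k) by case: k => [|k]; [case: (io 0)|case: (io k)].
have /choice[p pP] : forall k, exists p : seq V, [/\ path e (a k) p,
    last (a k) p = out k, uniq (a k :: p) & forall x : V, x \in a k :: p -> S k x].
  move=> k; have [Su _ _] := io k.
  by apply: linked_simple_path => //; apply: (proj2 (Sco k)).
pose Q := fix Q n : seq V :=
  if n is m.+1 then Q m ++ a n :: p n else p 0.
pose L n := a 0 :: Q n.
have LS n : L n.+1 = L n ++ a n.+1 :: p n.+1 by [].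
have sizeL n : n < size (L n).
  elim: n => // n IH; rewrite LS size_cat /=.
  by rewrite addnS ltnS; apply: leq_trans IH (leq_addr _ _).
have LQ n (x : V) : x \in L n -> exists2 k, k <= n & S k x.
  elim: n => [|n IH]; first by have [_ _ _ pS] := pP 0 => /pS; exists 0.
  rewrite LS mem_cat => /orP[/IH[k kn Sx]|]; first by exists k => //; exact: leqW.
  by have [_ _ _ pS] := pP n.+1 => /pS; exists n.+1.
have uniqL n : uniq (L n).
  elim: n => [|n IH]; first by case: (pP 0).
  have [_ _ up pS] := pP n.+1.
  rewrite LS cat_uniq IH up andbT andTb; apply/hasPn => x /pS Sx.
  apply/negP => /LQ[k kn /(Sdis _ _ _ Sx) nk].
  by move: kn; rewrite -nk ltnn.
have pathQ n : path e (a 0) (Q n) /\ last (a 0) (Q n) = out n.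
  elim: n => [|n [IHp IHl]]; first by case: (pP 0).
  have [ep lp _ _] := pP n.+1; have [_ _ uv] := io n.
  rewrite /= cat_path last_cat IHp IHl /= lp ep andbT; split=> //.
  exact/asboolP.
pose r i : V := nth (a 0) (L i) i.
have rE n i : i <= n -> r i = nth (a 0) (L n) i.
  elim: n => [|n IH]; first by rewrite leqn0 => /eqP->.
  rewrite leq_eqVlt => /predU1P[->//|]; rewrite ltnS => i_n.
  by rewrite LS nth_cat (leq_ltn_trans i_n (sizeL n)) IH.
have rI : injective r.
  move=> i j; have := leq_maxl i j; have := leq_maxr i j.
  move: (maxn i j) => n jn i_n; rewrite (rE n) // (rE n j) // => /eqP.
  by rewrite nth_uniq ?(leq_ltn_trans _ (sizeL n)) // => /eqP.
have r_adj n : adj (r n) (r n.+1).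
  rewrite (rE n.+1 n) // (rE n.+1 n.+1) //.
  have [/(pathP (a 0))/(_ n) en _] := pathQ n.+1.
  by apply/asboolP; apply: en; have := sizeL n.+1.
exists (Ray rI r_adj) => n; exists (size (L n)) => i ni /=.
suff block m : size (L n) <= i < size (L (n + m)) ->
    tail_union S n (nth (a 0) (L (n + m)) i).
  rewrite (rE (n + i)) ?leq_addl //; apply: block.
  by rewrite ni (leq_ltn_trans (leq_addl n i)).
elim: m => [|m IH]; first by rewrite addn0 ltnNge andbN.
rewrite addnS; have [im|mi] := ltnP i (size (L (n + m))).
  by move=> _; rewrite LS nth_cat im; apply: IH; rewrite ni.
move=> /andP[_ im]; exists (n + m).+1; first by rewrite leqW ?leq_addr.
have [_ _ _ pS] := pP (n + m).+1; apply: pS.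
rewrite LS nth_cat ltnNge mi /=; apply: mem_nth.
by rewrite ltn_subLR //; move: im; rewrite LS size_cat.
Qed.

End Connected.

(** * Ends living in a component *)

Section EndsIn.
Variable G : graph.
Implicit Types (C D F K : set G) (r s : ray G) (eps eta : end_space G).

Definition ends_in D : set (end_space G) :=
  [set eta | exists2 r, end_rays eta r & range r `<=` D].

Lemma end_rays_equiv eps r s : end_rays eps r -> end_rays eps s ->
  ray_equiv r s.
Proof.
case: eps => E [t EE]; rewrite /end_rays /= EE => tr ts.
exact: ray_equiv_trans (ray_equiv_sym tr) ts.
Qed.

Lemma end_rays_closed eps r s : end_rays eps r -> ray_equiv r s ->
  end_rays eps s.
Proof.
case: eps => E [t EE]; rewrite /end_rays /= EE => tr rs.
exact: ray_equiv_trans tr rs.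
Qed.

Lemma end_rays_nonempty eps : exists r, end_rays eps r.
Proof.
by case: eps => E [t EE]; exists t; rewrite /end_rays /= EE; exact: ray_equiv_refl.
Qed.

Lemma end_rays_inj eps eta r : end_rays eps r -> end_rays eta r -> eps = eta.
Proof.
move=> er hr; have E : end_rays eps = end_rays eta.
  apply/seteqP; split=> s sr.
    exact: end_rays_closed hr (end_rays_equiv er sr).
  exact: end_rays_closed er (end_rays_equiv hr sr).
case: eps eta E {er hr} => [A PA] [B PB]; rewrite /end_rays /= => AB.
by move: PA PB; rewrite AB => PA PB; congr exist; exact: Prop_irrelevance.
Qed.

Definition end_of r : end_space G := exist _ [set s | ray_equiv r s]
  (ex_intro _ r erefl).

Lemma end_ofP r : end_rays (end_of r) r.
Proof. exact: ray_equiv_refl. Qed.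

Definition ray_drop r n : ray G :=
  @Ray G (fun i => r (n + i))
    (fun i j rij => addnI (ray_inj rij))
    (fun i => eq_ind_r (fun k => adj (r (n + i)) (r k)) (ray_adj r (n + i))
                (addnS n i)).

Lemma ray_drop_equiv r n : ray_equiv r (ray_drop r n).
Proof.
move=> F /(component_tail_exists r)[C cC [k kC]]; exists C; split=> //.
  by exists k.
by exists k => i ki; apply: kC; exact: leq_trans ki (leq_addl _ _).
Qed.

(** Rays of one end have tails in the same component, so an end with a single
    ray inside [C] has no choice; this makes the sets of ends living in the
    components of the graph minus [K] disjoint and open. *)
Lemma ends_in_component K C eta : finite_set K -> component K C ->
  ends_in C eta <-> end_component eta K = C.
Proof.
move=> Kfin cC; have [cE Etail] := end_componentP eta Kfin; split.
  move=> [r er rC]; apply: (component_tail_eq cE cC (Etail r er)).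
  by exists 0 => i _; apply: rC; exists i.
move=> EC; have [r er] := end_rays_nonempty eta; have [n nE] := Etail r er.
exists (ray_drop r n).
  exact: end_rays_closed er (ray_drop_equiv r n).
by move=> _ [i _ <-]; rewrite -EC; apply: nE; exact: leq_addr.
Qed.

Lemma ends_in_open K C : finite_set K -> component K C -> open (ends_in C).
Proof.
move=> Kfin cC; rewrite end_space_openE => eta /(ends_in_component _ Kfin cC) EC.
by exists K => //; rewrite /end_nbhd EC.
Qed.

(** Two ends with the same component for every finite set have equivalent
    rays. *)
Lemma end_space_closed1 eps : closed [set eps].
Proof.
rewrite -[[set eps]]setCK; apply: open_closedC.
rewrite end_space_openE => eta /= neq; apply: contrapT => nF; apply: neq.
have same F : finite_set F -> end_component eps F = end_component eta F.
  move=> Ffin; have [cE _] := end_componentP eta Ffin.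
  apply/(ends_in_component _ Ffin cE); apply: contrapT => ne; apply: nF.
  by exists F => // zeta hz ze; apply: ne; rewrite -ze.
have [[r er] [s hs]] := (end_rays_nonempty eps, end_rays_nonempty eta).
apply: (@end_rays_inj _ _ s hs); apply: (end_rays_closed er) => F Ffin.
have [[cE Er] [_ Es]] := (end_componentP eps Ffin, end_componentP eta Ffin).
exists (end_component eps F); split=> //; first exact: Er.
by rewrite same //; exact: Es.
Qed.

(** Deleting a finite set of vertices distributes the ends of [D] over the
    components that are left, so one of these inherits the failure to split. *)
Lemma unsplittable_component (U : set (set (end_space G))) K D :
  finite_set K -> (forall C, component K C -> (C `&` D) !=set0 -> C `<=` D) ->
  ~ splittable U (ends_in D) ->
  exists C, [/\ component K C, C `<=` D & ~ splittable U (ends_in C)].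
Proof.
move=> Kfin KD badD; apply: contrapT => noC; apply: badD.
pose A := ends_in @` [set C | component K C /\ C `<=` D].
have -> : ends_in D = \bigcup_(B in A) B.
  apply/seteqP; split=> eta.
    move=> [r er rD]; have [cE Et] := end_componentP eta Kfin.
    exists (ends_in (end_component eta K)); last first.
      by apply/(ends_in_component _ Kfin cE).
    exists (end_component eta K) => //; split=> //; apply: KD => //.
    have [n nE] := Et r er; exists (r n); split; first exact: nE.
    by apply: rD; exists n.
  by move=> [_ [C [_ CD] <-] [r er rC]]; exists r => // x /rC/CD.
apply: splittable_bigcup.
  move=> _ _ [B [cB _] <-] [C [cC _] <-] [eta [/= etaB etaC]].
  move/(ends_in_component _ Kfin cB): etaB => <-.
  by move/(ends_in_component _ Kfin cC): etaC => <-.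
move=> _ [C [cC CD] <-]; apply: contrapT => badC; apply: noC.
by exists C.
Qed.

End EndsIn.

Lemma finite_uniform_bound (T : Type) (F : set T) (P : T -> nat -> Prop) :
  finite_set F -> (forall x m n, m <= n -> P x m -> P x n) ->
  (forall x, F x -> exists n, P x n) -> exists n, forall x, F x -> P x n.
Proof.
move=> /(@finite_seqP {classic T})[s ->] Pmono.
elim: s => [_|y s IH sP]; first by exists 0.
have [|n nP] := IH; first by move=> x xs; apply: sP; rewrite /= inE; apply/orP; right.
have [|m mP] := sP y; first by rewrite /= mem_head.
exists (maxn m n) => x /=; rewrite inE => /orP[/eqP->|xs].
  exact: Pmono (leq_maxl _ _) mP.
exact: Pmono (leq_maxr _ _) (nP x xs).
Qed.

(** * Ultraparacompactness of end spaces *)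

Section Ultraparacompact.
Variables (G : graph) (U : set (set (end_space G))).
Implicit Types (C D F K S : set G).

Let bad D := ~ splittable U (ends_in D).

(** The state of the construction: [region] is the bad component reached after
    deleting [sep], and the next finite connected set has to contain the vertex
    [entry]. The set [todo] and the component [target] are a wish made by the
    previous step: by deleting [todo] as well, the next step can descend into
    [target]. *)
Record stage := Stage {
  sep : set G;
  region : set G;
  entry : G;
  target : set G;
  sep_finite : finite_set sep;
  region_component : component sep region;
  region_bad : bad region;
  region_entry : region entry;
  todo : set G;
  todo_finite : finite_set todo;
  todo_sub : todo `<=` region;
  target_component : component (sep `|` todo) target;
  target_sub : target `<=` region;
  target_bad : bad target
}.

(** Deleting finitely many vertices of [D] cannot cut the badness of the region
    off from [S]; as the ray will pass through [S], this ties badness to the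
    ray. *)
Definition confines s S D := forall F C, finite_set F -> F `<=` D ->
  component (sep s `|` F) C -> C `<=` region s `\` S ->
  splittable U (ends_in C).

Record step (s : stage) S (t : stage) : Prop := Step {
  step_connected : graph_connected S;
  step_sub : S `<=` region s;
  step_entry : S (entry s);
  step_sep : sep t = sep s `|` S;
  step_region : region t `<=` target s;
  step_edge : exists2 u, S u & adj u (entry t);
  step_progress : confines s S (region t) \/
    forall u v, S u -> target t v -> ~ adj u v
}.

(** If [S] is not confining, some finite [F] in the new region [D] cuts off a bad
    component [C] of the old region that is disjoint from [S]. Such a [C] lies in
    [D], for it has a neighbour in [F], and it has no neighbour in [S], for its
    neighbours in the region belong to [F]. So the wish to descend into [C] is a
    legitimate one, and it makes progress of the second kind. *)
Lemma step_exists s : exists S t, step s S t.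
Proof.
have [regK regco _] := region_component s.
have [S [Sfin SD Sco Sx todoS]] := finite_connected_hull regco
  (region_entry s) (todo_finite s) (@todo_sub s).
pose K := sep s `|` S.
have Kfin : finite_set K by rewrite finite_setU; split=> //; exact: sep_finite.
have sepK : sep s `|` todo s `<=` K by move=> y [Ky|/todoS Sy]; [left|right].
have [D [cD DC badD]] : exists D, [/\ component K D, D `<=` target s & bad D].
  apply: unsplittable_component (@target_bad s) => // E [EK Eco _] [x [Ex gx]].
  apply: (connected_sub_component (target_component s) Eco _ gx Ex).
  by move=> y /EK Ky /sepK.
have Dreg := subset_trans DC (@target_sub s).
have [DK [[d Dd] _] _] := cD.
have DS x : D x -> ~ S x by move=> /DK Kx Sx'; apply: Kx; right.
have [a [b [Da regb nDb ab]]] := connected_leaving_edge regco (Dreg d Dd)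
  (region_entry s) Dd (fun De => DS _ De Sx).
have Sb : S b.
  apply: contrapT => nSb; apply: nDb; apply: (component_adj cD Da ab).
  by move=> [Kb|//]; exact: (regK b).
have [[F [C [Ffin FD cC CDS badC]]]|none] := pselect (exists F C,
    [/\ finite_set F, F `<=` D, component (sep s `|` F) C,
        C `<=` region s `\` S & bad C]); last first.
  have cD0 : component (K `|` set0) D by rewrite setU0.
  exists S, (Stage Kfin cD badD Da (finite_set0 G) (@sub0set _ D) cD0
    (@subset_refl _ D) badD).
  split=> //; first by exists b => //; exact: adj_sym.
  left=> F C Ffin FD cC CDS; apply: contrapT => badC; apply: none.
  by exists F, C.
have [CF Cco Cmax] := cC; have [[c Cc] _] := Cco.
have Creg x : C x -> region s x by move=> /CDS[].
have CS x : C x -> ~ S x by move=> /CDS[].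
have CK : C `<=` ~` K.
  by move=> x Cx [Kx|]; [apply: (CF x Cx); left|exact: CS].
have [u [f [Cu regf nCf uf]]] := connected_leaving_edge regco (Creg c Cc)
  (region_entry s) Cc (fun Ce => CS _ Ce Sx).
have Ff : F f.
  apply: contrapT => nFf; apply: nCf; apply: (component_adj cC Cu uf).
  by move=> [Kf|//]; exact: (regK f).
have Du : D u.
  by apply: (component_adj cD (FD f Ff) (adj_sym uf)); exact: CK.
have CD : C `<=` D := connected_sub_component cD Cco CK Du Cu.
have cC' : component (K `|` F) C.
  split=> //; first by move=> x Cx [/(CK x Cx)|Fx] //; apply: (CF x Cx); right.
  move=> E CE EKF Eco; apply: Cmax => // x Ex KFx; apply: (EKF x Ex).
  by case: KFx => [Kx|Fx]; [left; left|right].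
exists S, (Stage Kfin cD badD Da Ffin FD cC' CD badC).
split=> //; first by exists b => //; exact: adj_sym.
right=> y z Sy /= Cz yz; apply: (CS y) => //.
apply: (component_adj cC Cz (adj_sym yz)).
by move=> [Ky|Fy]; [exact: (regK y (SD y Sy))|exact: (DS y (FD y Fy))].
Qed.

Lemma ends_splittable : open_cover U -> splittable U [set: end_space G].
Proof.
move=> [oU covU]; apply: contrapT => badT.
have [D0 [cD0 _ badD0]] : exists D, [/\ component set0 D, D `<=` setT & bad D].
  apply: unsplittable_component => //.
  suff -> : ends_in setT = [set: end_space G] by [].
  by apply/seteqP; split=> // eta _; have [r] := end_rays_nonempty eta; exists r.
have [_ [[x0 Dx0] _] _] := cD0.
have cD00 : component (set0 `|` set0) D0 by rewrite setU0.
pose s0 := Stage (finite_set0 G) cD0 badD0 Dx0 (finite_set0 G)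
  (@sub0set _ D0) cD00 (@subset_refl _ D0) badD0.
have /choice[g gP] : forall s, exists St : set G * stage, step s St.1 St.2.
  by move=> s; have [S [t st]] := step_exists s; exists (S, t).
pose st n := iter n (fun s => (g s).2) s0.
pose S n := (g (st n)).1; pose D n := region (st n).
have Hstep n : step (st n) (S n) (st n.+1) by exact: gP.
have Dnext n : D n.+1 `<=` D n.
  exact: subset_trans (step_region (Hstep n)) (@target_sub _).
have Ddec m n : m <= n -> D n `<=` D m.
  elim: n => [|n IH]; first by rewrite leqn0 => /eqP->.
  rewrite leq_eqVlt => /predU1P[->//|/IH]; exact: subset_trans (Dnext n).
have Dcomp n : component (sep (st n)) (D n) by exact: region_component.
have DS n x : D n.+1 x -> ~ S n x.
  have [DK _ _] := Dcomp n.+1.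
  by move=> /DK Kx Sx; apply: Kx; rewrite (step_sep (Hstep n)); right.
have SD n x : S n x -> D n x by move=> Sx; apply: (step_sub (Hstep n)).
have Sdis j k x : S j x -> S k x -> j = k.
  wlog jk : j k / j < k => [wl Sj Sk|Sj Sk].
    by have [/wl->|/wl->|] := ltngtP j k.
  by case: (@DS j x _ Sj); apply: (Ddec _ _ jk); exact: SD.
have Sco n : graph_connected (S n) by exact: step_connected (Hstep n).
have Sadj n : exists u v, [/\ S n u, S n.+1 v & adj u v].
  have [u Su uv] := step_edge (Hstep n); exists u, (entry (st n.+1)).
  by split=> //; exact: step_entry (Hstep n.+1).
have [r rtail] := ray_through Sco Sdis Sadj.
have [O UO Oeps] : exists2 O, U O & O (end_of r).
  by have : [set: end_space G] (end_of r) by []; rewrite -covU => -[O]; exists O.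
have := oU O UO; rewrite end_space_openE => /(_ _ Oeps)[F Ffin FO].
have [cE Etail] := end_componentP (end_of r) Ffin.
(* From the index [m] on, [F] meets the regions in a constant set. *)
have [m mF] : exists m, forall x, F x -> D m x -> forall n, D n x.
  apply: finite_uniform_bound => // [x j k jk jD /(Ddec _ _ jk)//|x Fx].
  have [/existsNP[n nD]|/contrapT all] :=
    pselect (~ forall n, D n x); last by exists 0.
  by exists n => /nD.
pose T := tail_union S m.
have TF : T `<=` ~` F.
  move=> x [k mk Sx] Fx; apply: (DS k x) => //; apply: mF => //.
  by apply: (Ddec _ _ mk); exact: SD.
have TE : T `<=` end_component (end_of r) F.
  have [[i Ti] [j Ej]] := (rtail m, Etail r (end_ofP r)).
  apply: (connected_sub_component (x := r (maxn i j)) cE) => //.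
  - exact: tail_union_connected.
  - by apply: Ej; exact: leq_maxr.
  - by apply: Ti; exact: leq_maxl.
have small K C x : finite_set K -> component K C -> C `<=` ~` F ->
    C x -> T x -> splittable U (ends_in C).
  move=> Kfin cC CF Cx Tx; apply: (splittable_open (ends_in_open Kfin cC) UO).
  apply: subset_trans FO => eta [s es sC]; exists s => // y /sC.
  have [_ Cco _] := cC; apply: (connected_sub_component cE Cco CF _ Cx).
  exact: TE.
pose F0 := F `&` D m.
have [[n mn conf]|noconf] :=
    pselect (exists2 n, m <= n & confines (st n) (S n) (D n.+1)).
  have F0fin : finite_set F0 by apply: finite_setIl.
  have Kfin : finite_set (sep (st n) `|` F0).
    by rewrite finite_setU; split=> //; exact: sep_finite.
  have [C [cC CD badC]] : exists C,
      [/\ component (sep (st n) `|` F0) C, C `<=` D n & bad C].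
    apply: unsplittable_component (@region_bad (st n)) => //.
    move=> C [CK Cco _] [x [Cx Dx]].
    apply: (connected_sub_component (Dcomp n) Cco _ Dx Cx) => y /CK Ky Sy.
    by apply: Ky; left.
  have CF : C `<=` ~` F.
    move=> x Cx Fx; have [CK _ _] := cC; apply: (CK x Cx); right.
    by split=> //; exact: Ddec mn _ (CD x Cx).
  apply: badC; have [[x [Cx Sx]]|noS] := pselect ((C `&` S n) !=set0).
    by apply: (small _ _ x Kfin cC CF Cx); exists n.
  apply: (conf F0 C) => // [x [Fx Dx]|x Cx]; first exact: mF.
  by split; [exact: CD|move=> Sx; apply: noS; exists x].
have [[v [Fv Dv]]|noF] := pselect (F0 !=set0); last first.
  apply: (@region_bad (st m)).
  apply: (small _ _ (entry (st m)) (sep_finite _) (Dcomp m)).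
  - by move=> x Dx Fx; apply: noF; exists x.
  - exact: region_entry.
  - by exists m => //; exact: step_entry (Hstep m).
(* It remains to see that [v] cannot lie in all regions. Inside [D m], an edge
   leads from a vertex [a] that leaves the regions to a vertex [b] that never
   does; [a] is then in the set [S k] where it leaves, yet adjacent to [b] in
   [D k.+2]. *)
pose A x := D m x /\ exists n, ~ D n x.
have [_ Dmco _] := Dcomp m.
have Ae : A (entry (st m)).
  split; first exact: region_entry.
  by exists m.+1 => /DS; apply; exact: step_entry (Hstep m).
have nAv : ~ A v by move=> [_ [n]]; apply; exact: mF.
have [a [b [[Dma [n nDa]] Dmb nAb ab]]] := connected_leaving_edge Dmco
  (region_entry (st m)) Dv Ae nAv.
have Db k : D k b by apply: contrapT => nDb; apply: nAb; split=> //; exists k.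
have [k [mk Dka nDka]] : exists k, [/\ m <= k, D k a & ~ D k.+1 a].
  elim: n nDa => [|n IH] nDa; first by case: nDa; exact: Ddec Dma.
  have [Da|/IH//] := pselect (D n a); exists n; split=> //.
  by rewrite leqNgt; apply/negP => nm; apply: nDa; exact: Ddec nm _ Dma.
have Sa : S k a.
  apply: contrapT => nSa; apply: nDka.
  apply: (component_adj (Dcomp k.+1) (Db k.+1) (adj_sym ab)).
  rewrite (step_sep (Hstep k)) => -[Ka|//].
  by have [DK _ _] := Dcomp k; exact: (DK a Dka).
have [conf|away] := step_progress (Hstep k); first by apply: noconf; exists k.
apply: (away a b Sa _ ab); apply: (step_region (Hstep k.+1)); exact: (Db k.+2).
Qed.

End Ultraparacompact.

Theorem proposition2p11 (G : graph) :
  [set: extent (end_space G)] #= [set: lindelof_degree (end_space G)] /\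
  [set: lindelof_degree (end_space G)] #<= [set: cellularity (end_space G)].
Proof.
split.
  rewrite card_eq_le extent_le_lindelof /=; apply: lindelof_le_partition.
    exact: infinite_add_nat.
  move=> U /ends_splittable[P PU]; exists P => //.
  exact: partition_card_le_extent (@end_space_closed1 G) PU.
apply: lindelof_le_partition; first exact: infinite_add_nat.
move=> U /ends_splittable[P PU]; exists P => //.
apply: card_le_trans (partition_card_le_cellularity PU).
exact: subset_card_le (@subDsetl _ _ _).
Qed.
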